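(* For every integer $m\ge2$ there exists a stationary sequence $(Z_n)_{n\in\mathbb{N}}$ of random variables taking values in $S^1\cup\{0\}$, which is not independent, such that almost surely $(Z_n)_{n\in\mathbb{N}}$ has index $m$ and is a Chowla sequence.
   Context: $\mathbb{N}=\{0,1,2,\dots\}$, $\mathbb{N}_{\ge 2}=\mathbb{N}\setminus\{0,1\}$, and $S^1$ is the unit circle in $\mathbb{C}$. For $m\in\mathbb{N}_{\ge2}$ let $U(m)=\{e^{2\pi i k/m}:0\le k\le m-1\}$, and $U(\infty)=S^1$. The index of a sequence $z=(z(n))_{n\in\mathbb{N}}\in(S^1\cup\{0\})^{\mathbb{N}}$ is the smallest $m\in\mathbb{N}_{\ge2}\cup\{\infty\}$ such that $\{n\in\mathbb{N}: z(n)\notin U(m)\cup\{0\}\}$ has density zero in $\mathbb{N}$, i.e. $\frac1N\#\{0\le n\le N-1: z(n)\notin U(m)\cup\{0\}\}\to0$. For $x\in S^1\cup\{0\}$ and $n\in\mathbb{Z}$, put $x^{(n)}=x^n$ if $x\in S^1$ and $x^{(n)}=0$ if $x=0$; write $z^{(i)}(n)=(z(n))^{(i)}$. Let $I(m)=\{0,1,\dots,m-1\}$ if $m\in\mathbb{N}_{\ge2}$, and $I(\infty)=\mathbb{Z}$. A sequence $z\in(S^1\cup\{0\})^{\mathbb{N}}$ of index $m$ has the Chowla property (is a Chowla sequence) if $$\lim_{N\to\infty}\frac1N\sum_{n=0}^{N-1} z^{(i_1)}(n+a_1)\,z^{(i_2)}(n+a_2)\cdots z^{(i_r)}(n+a_r)=0$$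 for every $r\ge1$, all integers $0\le a_1<\dots<a_r$ and all $i_1,\dots,i_r\in I(m)$ not all equal to $0$. *)

(* Defs.v *)
From HB Require Import structures.
From mathcomp Require Import all_boot all_order all_algebra complex.
From mathcomp Require Import all_classical all_reals all_analysis.

Set Implicit Arguments.
Unset Strict Implicit.
Unset Printing Implicit Defensive.

Import Order.TTheory GRing.Theory Num.Theory.
Import numFieldNormedType.Exports.

Local Open Scope classical_set_scope.
Local Open Scope ring_scope.

(** R[i] as a [numClosedFieldType]: this is what makes the library infer the
    topology of the modulus on it. *)
Definition Cplx (R : realType) : numClosedFieldType := R[i].

Definition borelC (R : realType) : measurableType (@open (Cplx R)).-sigma :=
  g_sigma_algebraType (@open (Cplx R)).

Section sequences.
Context {R : realType}.
Implicit Types (x : Cplx R) (z : nat -> Cplx R).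

(** Elements of $\mathbb{N}_{\ge 2} \cup \{\infty\}$ are encoded in
    [option nat], with [None] for infinity. *)
Definition admissible_index (m : option nat) : Prop :=
  if m is Some k then (2 <= k)%N else True.

Definition le_index (m1 m2 : option nat) : Prop :=
  match m1, m2 with
  | _, None => True
  | None, Some _ => False
  | Some k1, Some k2 => (k1 <= k2)%N
  end.

Definition circle : set (Cplx R) := [set x | `|x| = 1].

Definition circle0 : set (Cplx R) := circle `|` [set 0].

Definition cexpi (t : R) : Cplx R := (cos t +i* sin t)%C.

Definition unity_roots (m : option nat) : set (Cplx R) :=
  if m is Some k then
    [set cexpi (2 * pi * j%:R / k%:R) | j in [set j : nat | (j < k)%N]]
  else circle.

Definition density_zero (S : set nat) : Prop :=
  (#|[pred n : 'I_N | `[< S n >]]|%:R / N%:R : R) @[N --> \oo] --> (0 : R).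

Definition index_bound (m : option nat) z : Prop :=
  density_zero [set n | ~ (unity_roots m `|` [set 0]) (z n)].

Definition is_index (m : option nat) z : Prop :=
  [/\ admissible_index m, index_bound m z &
      forall k, admissible_index k -> index_bound k z -> le_index m k].

(** The power $x^{(n)}$, which is 0 at x = 0 even when n = 0. *)
Definition cpow x (n : int) : Cplx R := if x == 0 then 0 else x ^ n.

Definition exponents (m : option nat) : set int :=
  if m is Some k then [set i | 0 <= i < k%:Z] else setT.

Definition vanishing_correlations (m : option nat) z : Prop :=
  forall (r : nat) (a : 'I_r -> nat) (i : 'I_r -> int),
    (1 <= r)%N ->
    (forall j k : 'I_r, (j < k)%N -> (a j < a k)%N) ->
    (forall j, exponents m (i j)) ->
    (exists j, i j != 0) ->
    ((\sum_(n < N) \prod_(j < r) cpow (z (n + a j)%N) (i j)) / N%:R)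
      @[N --> \oo] --> (0 : Cplx R).

Definition is_chowla z : Prop :=
  exists2 m, is_index m z & vanishing_correlations m z.

End sequences.

Section processes.
Context {d : measure_display} {T : measurableType d} {R : realType}.
Variable P : probability T R.

(** The product sigma-algebra on the space of complex sequences. *)
Definition sequence_measurable : set (set (nat -> borelC R)) :=
  <<s [set E | exists n : nat, exists2 B : set (borelC R),
         measurable B & E = [set x | B (x n)]] >>.

Definition stationary (Z : nat -> {RV P >-> borelC R}) : Prop :=
  forall (h : nat) (E : set (nat -> borelC R)), sequence_measurable E ->
    P [set w | E (fun n => Z (n + h)%N w)] = P [set w | E (fun n => Z n w)].

Definition independent (Z : nat -> {RV P >-> borelC R}) : Prop :=
  forall (J : seq nat) (B : nat -> set (borelC R)),
    uniq J -> (forall j, measurable (B j)) ->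
    P (\bigcap_(j in [set` J]) (Z j @^-1` B j)) =
    (\prod_(j <- J) P (Z j @^-1` B j))%E.

End processes.

(* Main.v *)
Require Import Defs.
From HB Require Import structures.
From mathcomp Require Import all_boot all_order all_algebra complex ring lra zify.
From mathcomp Require Import all_classical all_reals all_analysis measurable_realfun.

(** Let [(u_n, b_n)] be i.i.d. uniform in [Z/m * {0, 1}], let [zeta] be a
    primitive [m]-th root of unity, and put [Z_n = zeta ^ u_n] if
    [b_n = b_(n+1) = 1] and [Z_n = 0] otherwise.

    Write [X_n] for the [n]-th summand of a correlation with an exponent that is
    nonzero, and let [p] be the first site at which [X_n] has a nonzero exponent.
    Adding 1 to [u_p] preserves the measure, multiplies [X_n] by a root of unity
    other than 1, and fixes [X_k] for [k > n]. Hence the bounded variables [X_n]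
    are orthogonal, their partial sums have second moment at most [N], and the
    averages tend to 0 almost surely, first along the squares. Flipping single
    bits gives in the same way that [b_n b_(n+1)] has average 1/4; by Fourier
    inversion on [Z/m] the value [zeta] is then taken with density [1/(4m)],
    so that the index is not smaller than [m]. Finally
    [P(b_0 b_1 b_2 = 1) = 1/8] differs from [P(b_0 b_1 = 1) P(b_1 b_2 = 1) = 1/16]. *)

Set Implicit Arguments.
Unset Strict Implicit.
Unset Printing Implicit Defensive.

Import Order.TTheory GRing.Theory Num.Theory.
Import numFieldNormedType.Exports.
Import Num.Def.

Local Open Scope classical_set_scope.
Local Open Scope ring_scope.

(** * The uniform Bernoulli measure on words *)

HB.instance Definition _ n := isPointed.Build 'I_n.+1 ord0.

HB.structure Definition PointedFinite := {A of Pointed A & Finite A}.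

Section words.
Variable A : PointedFinite.type.
Implicit Types (x y : nat -> A).

Definition cylinder y L : set (nat -> A) :=
  [set x | forall n, (n < L)%N -> x n = y n].

(** Two cylinders are nested or disjoint; adjoining the empty set makes the family stable under
    intersection. *)
Definition cylinders : set (set (nat -> A)) :=
  [set E | E = set0 \/ exists y L, E = cylinder y L].

Definition words : Type := g_sigma_algebraType cylinders.

HB.instance Definition _ := Measurable.on words.

(** Since the alphabet is finite, such an [f] takes finitely many values; this is the source of
    measurability and integrability below. *)
Definition depends_on_prefix L (T : Type) (f : words -> T) :=
  forall x y, (forall n, (n < L)%N -> x n = y n) -> f x = f y.

Lemma cylinder0 y : cylinder y 0 = setT.
Proof. by apply/seteqP; split. Qed.

Lemma cylinderE y L x : cylinder y L x -> cylinder y L = cylinder x L.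
Proof.
by move=> yx; apply/seteqP; split => z zE n nL; rewrite zE// yx.
Qed.

Lemma cylinders_setI : setI_closed cylinders.
Proof.
move=> E F [->|[y [L ->]]]; first by left; rewrite set0I.
case=> [->|[y' [L' ->]]]; first by left; rewrite setI0.
have [->|/set0P[x [xy xy']]] := eqVneq (cylinder y L `&` cylinder y' L') set0.
  by left.
right; exists x, (maxn L L').
rewrite (cylinderE xy) (cylinderE xy'); apply/seteqP; split => z.
  by move=> [z1 z2] n; rewrite leq_max => /orP[/z1|/z2].
by move=> zE; split => n nL; apply: zE; rewrite leq_max nL ?orbT.
Qed.

Lemma measurable_cylinder y L : measurable (cylinder y L : set words).
Proof. by apply: sub_sigma_algebra; right; exists y, L. Qed.

Definition extend L (w : {ffun 'I_L -> A}) : nat -> A :=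
  fun n => if insub n is Some i then w i else point.

(** There are finitely many prefixes of length [L], so [E] is a finite union of cylinders; [extend]
    picks a representative word for each prefix. *)
Lemma measurable_prefix_set L (E : set words) :
  depends_on_prefix L E -> measurable E.
Proof.
move=> LE.
rewrite (_ : E = \bigcup_(w in [set w : {ffun 'I_L -> A} | E (extend w)])
    (cylinder (extend w) L : set words)).
  apply: fin_bigcup_measurable => // w _; exact: measurable_cylinder.
apply/seteqP; split=> [x Ex|x [w /= Ew wx]].
- pose w := [ffun i : 'I_L => x i].
  have wx : cylinder (extend w) L x.
    by move=> n nL; rewrite /extend insubT/= ffunE.
  by exists w => //=; rewrite -(LE x).
- by rewrite (LE _ (extend w)).
Qed.

Lemma measurable_fun_prefix d (T : measurableType d) L (f : words -> T) :
  depends_on_prefix L f -> measurable_fun setT f.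
Proof.
move=> Lf _ B mB; rewrite setTI; apply: (@measurable_prefix_set L) => x y xy.
by rewrite /preimage/= (Lf x y).
Qed.

End words.

(** * Base-[q] expansion of a uniform real number *)

Section base_expansion.
Variables (R : realType) (A : PointedFinite.type).
Local Notation q := #|A|.

Lemma card_pointed_gt0 : (0 < q)%N.
Proof. by apply/card_gt0P; exists (point : A). Qed.

(** The digits after the point, read as letters. For [r] uniform in [0, 1] they are i.i.d. uniform,
    which replaces the construction of an infinite product measure. *)
Definition digits (r : measurableTypeR R) : words A :=
  fun n => nth point (enum A) (truncn (q%:R ^+ n.+1 * r) %% q).

Lemma truncn_mul_divn (p : nat) (r : R) : (0 < p)%N -> 0 <= r ->
  (truncn (p%:R * r) %/ p)%N = truncn r.
Proof.
move=> p0 r0; have pr0 : 0 <= p%:R * r by rewrite mulr_ge0.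
apply/esym/truncn_def.
have p0' : 0 < p%:R :> R by rewrite ltr0n.
rewrite -(ler_pM2l p0') -(ltr_pM2l p0') -!natrM.
have /andP[h1 h2] := truncn_itv pr0.
apply/andP; split.
  by apply: le_trans h1; rewrite ler_nat mulnC leq_divM.
by apply: lt_le_trans h2 _; rewrite ler_nat mulnC ltn_ceil.
Qed.

(* [K] is the integer written [y 0 ... y (L-1)] in base [q]. *)
Lemma digits_cylinderE (y : nat -> A) L : exists2 K, (K < q ^ L)%N &
  forall r : R, 0 <= r < 1 ->
  cylinder y L (digits r) <-> truncn (q%:R ^+ L * r) = K.
Proof.
have q0 := card_pointed_gt0.
elim: L => [|L [K KL IH]].
  exists 0%N => // r /andP[r0 r1]; split => // _.
  by rewrite expr0 mul1r; apply: truncn_def; rewrite r0 r1.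
exists (K * q + index (y L) (enum A))%N.
  have yq : (index (y L) (enum A) < q)%N by rewrite cardE index_mem mem_enum.
  rewrite expnSr; apply: (@leq_trans (K * q + q)%N); first by rewrite ltn_add2l.
  by rewrite -mulSnr leq_pmul2r.
move=> r r01; have /andP[r0 r1] := r01.
have yq : (index (y L) (enum A) < q)%N by rewrite cardE index_mem mem_enum.
have cS : cylinder y L.+1 (digits r) <->
    cylinder y L (digits r) /\ digits r L = y L.
  split=> [h|[h1 h2] n].
    by split=> [n nL|]; apply: h => //; exact: ltnW.
  by rewrite ltnS leq_eqVlt => /predU1P[->//|]; exact: h1.
set t := truncn _.
have tq : truncn (q%:R ^+ L * r) = (t %/ q)%N.
  by rewrite /t exprS -mulrA truncn_mul_divn// mulr_ge0// exprn_ge0.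
have tm : digits r L = y L <-> (t %% q)%N = index (y L) (enum A).
  rewrite /digits -/t; have tq' : (t %% q < size (enum A))%N.
    by rewrite -cardE ltn_mod.
  split=> [<-|->]; first by rewrite index_uniq// enum_uniq.
  by rewrite nth_index// mem_enum.
rewrite cS IH// tm tq; split=> [[<- <-]|->].
  by rewrite -divn_eq.
by rewrite divnMDl// divn_small// addn0 modnMDl modn_small.
Qed.

Lemma measurable_truncn : measurable_fun setT (truncn : R -> nat).
Proof.
move=> _ B _; rewrite setTI (_ : _ @^-1` B =
    \bigcup_(k in B) [set x : R | truncn x = k]); last first.
  apply/seteqP; split => [x Bx|x [k Bk /= xk]]; first by exists (truncn x).
  by rewrite /preimage/= xk.
apply: bigcup_measurable => -[|k] _.
  (* [truncn] sends negative numbers to 0, so its fibre over 0 is unbounded below, unlike the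
     others. *)
  rewrite (_ : mkset _ = `]-oo, 1[%classic) //.
  apply/seteqP; split => x /=; rewrite in_itv/=.
    by move=> x0; have := truncn_le_nat x 0; rewrite x0 leqnn => <-.
  by rewrite -[1]/(1%:R) -(truncn_le_nat x 0) leqn0 => /eqP.
rewrite (_ : mkset _ = `[k.+1%:R, k.+2%:R[%classic) //.
apply/seteqP; split => x /=; rewrite in_itv/=.
  by move=> xk; rewrite -truncn_gt_nat -truncn_le_nat xk !leqnn.
rewrite -truncn_gt_nat -truncn_le_nat => /andP[h1 h2].
by apply/eqP; rewrite eqn_leq h1 h2.
Qed.

Lemma measurable_digits : measurable_fun [set: measurableTypeR R] digits.
Proof.
refine (@measurability _ _ _ _ setT digits (@cylinders A) erefl _) => _ [E + <-].
case=> [->|[y [L ->]]]; first by rewrite preimage_set0 setI0.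
rewrite setTI.
rewrite (_ : _ @^-1` _ = \bigcap_(n in `I_L) [set r | digits r n = y n]); last first.
  by apply/seteqP; split => r /=.
apply: fin_bigcap_measurable => // n _.
rewrite [X in measurable X](_ : _ =
  (fun r : R => truncn (q%:R ^+ n.+1 * r)) @^-1`
    [set k | nth point (enum A) (k %% q) = y n]) //.
rewrite -[X in measurable X]setTI.
suff : measurable_fun setT (fun r : R => truncn (q%:R ^+ n.+1 * r)).
  by apply.
apply: (measurableT_comp measurable_truncn).
exact: mulrl_measurable.
Qed.

HB.instance Definition _ := isMeasurableFun.Build _ _
  (measurableTypeR R) (words A) digits measurable_digits.

Lemma uniform_prob01E (U : set R) : measurable U ->
  uniform_prob (@ltr01 R) U = lebesgue_measure (U `&` `[0, 1[).
Proof.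
move=> mU; rewrite /uniform_prob integral_uniform_pdf.
rewrite (eq_integral (fun=> 1%E)); last first.
  by move=> x; rewrite inE/= in_itv/= /uniform_pdf => -[_ ->]; rewrite subr0 invr1.
rewrite integral_cst/= ?mul1e; last exact: measurableI.
have -> : U `&` `[0, 1] = (U `&` `[0, 1[) `|` (U `&` [set 1]).
  by rewrite -setIUr (@setUitv1 _ _ (BLeft 0) 1 true)// bnd_simp.
rewrite measureU0//; [exact: measurableI|exact: measurableI|].
have [U1|U1] := pselect (U 1).
  by rewrite setIidr; [exact: lebesgue_measure_set1|move=> _ ->].
by rewrite (_ : _ `&` _ = set0) ?measure0// -subset0 => x [+ x1]; rewrite x1.
Qed.

Definition bernoulli_measure : set (words A) -> \bar R :=
  distribution (uniform_prob (@ltr01 R)) digits.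

HB.instance Definition _ := Probability.on bernoulli_measure.

(** Prescribing the first [L] digits confines [r] to an interval [K / q^L, (K + 1) / q^L) inside [0,
    1), whose length is the claimed mass. *)
Lemma bernoulli_cylinder (y : nat -> A) L :
  bernoulli_measure (cylinder y L) = (q%:R ^- L)%:E.
Proof.
have q0 : 0 < q%:R ^+ L :> R by rewrite exprn_gt0// ltr0n card_pointed_gt0.
have [K KL KE] := digits_cylinderE y L.
transitivity (uniform_prob (@ltr01 R) (digits @^-1` cylinder y L)); first by [].
rewrite uniform_prob01E; last first.
  by rewrite -[X in measurable X]setTI; apply: measurable_digits => //;
    exact: measurable_cylinder.
rewrite (_ : _ `&` _ = `[K%:R / q%:R ^+ L, K.+1%:R / q%:R ^+ L[%classic).
  rewrite lebesgue_measure_itv/= lte_fin ltr_pM2r ?invr_gt0// ltr_nat ltnSn.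
  by rewrite -EFinB -mulrBl -natr1 addrAC subrr add0r mul1r.
have KI (r : R) : K%:R / q%:R ^+ L <= r < K.+1%:R / q%:R ^+ L <->
    K%:R <= q%:R ^+ L * r < K.+1%:R.
  by rewrite ler_pdivrMr// ltr_pdivlMr// mulrC.
apply/seteqP; split=> r /=; rewrite !in_itv/=.
  move=> [/KE{}KE r01]; apply/KI; rewrite -(KE r01); apply: truncn_itv.
  by apply: mulr_ge0; [exact: ltW|case/andP: r01].
move=> rK; have r01 : 0 <= r < 1.
  case/andP: rK => rK1 rK2; apply/andP; split.
    by apply: le_trans rK1; rewrite divr_ge0// ltW.
  apply: lt_le_trans rK2 _; rewrite ler_pdivrMr// mul1r -natrX ler_nat.
  exact: KL.
by split=> //; apply/KE => //; apply: truncn_def; exact/KI.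
Qed.

End base_expansion.

(** * Measure-preserving maps of the word space *)

Section preserving.
Variables (R : realType) (A : PointedFinite.type).
Local Notation P := (@bernoulli_measure R A).

Definition preserves_bernoulli (g : words A -> words A) :=
  measurable_fun setT g /\
  forall E, measurable E -> P (g @^-1` E) = P E.

(** Cylinders generate the sigma-algebra and are stable under intersection, so a probability measure
    is determined by its values on them. *)
Lemma preserves_bernoulli_cylinders (g : words A -> words A) :
  measurable_fun setT g ->
  (forall y L, P (g @^-1` cylinder y L) = P (cylinder y L)) ->
  preserves_bernoulli g.
Proof.
move=> mg gE; split=> // E mE.
pose Pg : {measure set (words A) -> \bar R} :=
  distribution P (HB.pack g (isMeasurableFun.Build _ _ _ _ _ mg) : {mfun _ >-> _}).
have sT : cylinders (setT : set (nat -> A)).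
  by right; exists (fun=> point), 0%N; rewrite cylinder0.
refine (@measure_unique _ R (words A) (@cylinders A) (fun=> setT) erefl _ _ _ Pg P _ _ E mE).
- exact: cylinders_setI.
- by [].
- by rewrite bigcup_const//; exists 0%N.
- by move=> F [->|[y [L ->]]]; rewrite ?measure0//; exact: gE.
- by move=> _; rewrite (le_lt_trans (probability_le1 _ _)) ?ltry.
Qed.

Definition shift_word (x : words A) : words A := fun n => x n.+1.

Lemma measurable_map_prefix (g : words A -> words A) :
  (forall L, exists M, depends_on_prefix M (fun x => g x L)) ->
  measurable_fun setT g.
Proof.
move=> gP; refine (@measurability _ _ _ _ setT g (@cylinders A) erefl _) => _ [E + <-].
case=> [->|[y [L ->]]]; first by rewrite preimage_set0 setI0.
rewrite setTI (_ : _ @^-1` _ = \bigcap_(n in `I_L) [set x | g x n = y n]); last first.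
  by apply/seteqP; split => r /=.
apply: fin_bigcap_measurable => // n _.
have [M gM] := gP n; apply: (@measurable_prefix_set _ M) => x x' xx'.
by rewrite /mkset (gM _ _ xx').
Qed.

(** The letter lost by the shift is free: a cylinder of length [L] pulls back to [q] disjoint
    cylinders of length [L + 1], and q * q^-(L+1) = q^-L. *)
Lemma shift_word_preserves : preserves_bernoulli shift_word.
Proof.
apply: preserves_bernoulli_cylinders.
  by apply: measurable_map_prefix => n; exists n.+2 => x y; exact.
move=> y L.
pose c (a : A) : nat -> A := fun n => if n is n'.+1 then y n' else a.
rewrite (_ : _ @^-1` _ = \bigcup_(a in [set: A]) cylinder (c a) L.+1); last first.
  apply/seteqP; split=> [x xy|x [a _ xa] n nL].
    by exists (x 0%N) => // -[|n]//= nL; exact: xy.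
  exact: (xa n.+1).
rewrite measure_fin_bigcup; last 3 first.
- exact: finite_finset.
- apply/trivIsetP => a b _ _ ab; rewrite -subset0 => x [xa xb].
  by move: ab; rewrite -[a](xa 0%N isT) -[b](xb 0%N isT) eqxx.
- by move=> a _; exact: measurable_cylinder.
transitivity (\sum_(a \in [set: A]) ((#|A|%:R ^- L.+1 : R)%:E))%E.
  by apply: eq_fsbigr => a _; exact: bernoulli_cylinder.
transitivity ((#|A|%:R ^- L : R)%:E); last exact/esym/bernoulli_cylinder.
have -> : [set: A] = [set` enum A].
  by apply/seteqP; split => // a _; rewrite /= mem_enum.
rewrite -fsbig_seq ?enum_uniq// sumEFin big_const_seq count_predT -cardE.
rewrite iter_addr_0 exprSr invfM; congr _%:E.
rewrite -[LHS]mulr_natr mulfVK // pnatr_eq0 -lt0n; exact: card_pointed_gt0.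
Qed.

Definition relabel (f : nat -> A -> A) (x : words A) : words A :=
  fun n => f n (x n).

(** Letterwise bijections pull a cylinder back to a cylinder of the same length, and the mass of a
    cylinder depends on its length only. *)
Lemma relabel_preserves f : (forall n, bijective (f n)) ->
  preserves_bernoulli (relabel f).
Proof.
move=> fb; apply: preserves_bernoulli_cylinders.
  by apply: measurable_map_prefix => n; exists n.+1 => x y xy; rewrite /relabel xy.
move=> y L; have /choice[g gK] : forall n, exists g, cancel (f n) g /\ cancel g (f n).
  by move=> n; have [g fK gK] := fb n; exists g.
rewrite (_ : _ @^-1` _ = cylinder (fun n => g n (y n)) L) ?bernoulli_cylinder//.
apply/seteqP; split=> x xy n nL.
  by rewrite -(xy n nL) /relabel (gK n).1.
by rewrite /relabel xy// (gK n).2.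
Qed.

End preserving.

(** * A strong law under a second moment bound *)

Section law_of_large_numbers.

Lemma exists_sqrt_bracket (N : nat) : (0 < N)%N ->
  exists k, (k.+1 ^ 2 <= N < k.+2 ^ 2)%N.
Proof.
elim: N => // -[_ _|N IH _]; first by exists 0%N.
have [//|k /andP[k1 k2]] := IH.
have [lt|ge] := ltnP N.+2 (k.+2 ^ 2).
  by exists k; rewrite lt (leq_trans k1).
exists k.+1; rewrite ge/=; apply: (@leq_ltn_trans (k.+2 ^ 2)) => //.
by rewrite ltn_sqr.
Qed.

(** Between consecutive squares (k+1)^2 and (k+2)^2 the increments add up to at most 2(k+1), which
    is negligible against (k+1)^2. *)
Lemma cvg_average_of_squares (R : realType) (s : nat -> R) :
  (forall N, `|s N.+1 - s N| <= 1) ->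
  s (k.+1 ^ 2)%N / k.+1%:R ^+ 2 @[k --> \oo] --> (0 : R) ->
  s N / N%:R @[N --> \oo] --> (0 : R).
Proof.
move=> ds /cvgrPdist_le ssq; apply/cvgrPdist_le => e e0.
have dsD N M : `|s (N + M)%N - s N| <= M%:R.
  elim: M => [|M IH]; first by rewrite addn0 subrr normr0.
  rewrite addnS (le_trans (ler_distD (s (N + M)%N) _ _))// -natr1 addrC lerD//.
have e2 : 0 < e / 2 by rewrite divr_gt0.
have [K _ HK] := ssq _ e2.
(* For k + 1 >= 4 / e the drift 2(k+1) is at most (e/2)(k+1)^2; the other half of [e] pays for the
   value at the square. *)
have [K' HK'] : exists K' : nat, 4 / e <= K'%:R.
  by exists (Num.truncn (4 / e)).+1; apply/ltW/truncnS_gt.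
exists ((maxn K K').+2 ^ 2)%N => // N /= NK.
have N0 : (0 < N)%N by apply: leq_trans NK; rewrite expn_gt0.
have [k /andP[k1 k2]] := exists_sqrt_bracket N0.
have kK : (maxn K K' <= k)%N.
  by have := leq_ltn_trans NK k2; rewrite ltn_sqr !ltnS => /ltnW.
have /= := HK k (leq_trans (leq_maxl _ _) kK).
have K'k : 4 / e <= k.+1%:R.
  apply: le_trans HK' _; rewrite ler_nat.
  by rewrite (leq_trans (leq_maxr K _))// ltnW.
rewrite !sub0r !normrN !normrM !normfV.
have N0' : 0 < N%:R :> R by rewrite ltr0n.
have k0 : 0 < k.+1%:R :> R by rewrite ltr0n.
have k20 : 0 < k.+1%:R ^+ 2 :> R by rewrite exprn_gt0.
rewrite (ger0_norm (ltW N0')) (ger0_norm (ltW k20)) => sk.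
rewrite ler_pdivrMr//.
move: sk; rewrite ler_pdivrMr ?exprn_gt0// => sk.
have := dsD (k.+1 ^ 2)%N (N - k.+1 ^ 2)%N; rewrite subnKC// => dsk.
have sN : `|s N| <= `|s (k.+1 ^ 2)%N| + (N - k.+1 ^ 2)%:R.
  by rewrite -(subrK (s (k.+1 ^ 2)%N) (s N)) addrC (le_trans (ler_normD _ _))// lerD2l.
have Nk : (N - k.+1 ^ 2 <= 2 * k.+1)%N.
  by rewrite leq_subLR; move: k2; clear; lia.
have Nk' : (N - k.+1 ^ 2)%:R <= 2 * k.+1%:R :> R by rewrite -natrM ler_nat.
have kN : k.+1%:R ^+ 2 <= N%:R :> R by rewrite -natrX ler_nat.
rewrite ler_pdivrMr// in K'k.
have : 4 * k.+1%:R <= e * k.+1%:R ^+ 2 :> R.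
  by rewrite expr2 mulrA ler_pM2r// mulrC.
have : e * k.+1%:R ^+ 2 <= e * N%:R by rewrite ler_pM2l.
lra.
Qed.

Context d (T : measurableType d) (R : realType) (P : probability T R).

Lemma sum_inv_squares_le (n : nat) :
  \sum_(k < n) (k.+1%:R ^+ 2)^-1 <= 2 :> R.
Proof.
(* The sharper bound makes the induction telescope, as 1/(n+1)^2 <= 1/n - 1/(n+1). At [n = 0] it
   reads 2, the inverse of 0 being 0, so the step to [n = 1] is done apart. *)
suff : \sum_(k < n) (k.+1%:R ^+ 2)^-1 <= 2 - n%:R^-1 :> R.
  by move=> /le_trans; apply; rewrite gerBl invr_ge0.
elim: n => [|n IH]; first by rewrite big_ord0 invr0 subr0 ler0n.
rewrite big_ord_recr/=; case: n IH => [_|n IH].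
  by rewrite big_ord0 expr1n !invr1; lra.
apply: (le_trans (lerD IH (lexx _))).
rewrite -addrA lerD2l.
have h1 : 0 < n.+1%:R :> R by rewrite ltr0n.
have -> : n.+2%:R = n.+1%:R + 1 :> R by rewrite natr1.
move: (n.+1%:R : R) h1 => x x0.
rewrite -subr_ge0 (_ : _ - _ = (x * (x + 1) ^+ 2)^-1).
  by rewrite invr_ge0 mulr_ge0 ?exprn_ge0 ?addr_ge0 ?ltW.
by field; rewrite !gt_eqF ?addr_gt0.
Qed.

Lemma ae_cvg_average_of_squares (S : nat -> T -> R) :
  (forall N, measurable_fun setT (S N)) ->
  (forall N w, `|S N.+1 w - S N w| <= 1) ->
  (forall N, \int[P]_w ((S N w) ^+ 2)%:E <= N%:R%:E)%E ->
  {ae P, forall w, S N w / N%:R @[N --> \oo] --> (0 : R)}.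
Proof.
move=> mS dS S2.
(* The series of the [(S_(k^2) / k^2)^2] has finite expectation, so its terms
   tend to 0 almost surely. *)
pose f k w := (((S (k.+1 ^ 2)%N w) / k.+1%:R ^+ 2) ^+ 2)%:E.
have f0 k w : (0 <= f k w)%E by rewrite lee_fin sqr_ge0.
have mf k : measurable_fun setT (f k).
  apply/measurable_EFinP; apply: measurable_funX.
  exact: measurable_funM.
have intf k : (\int[P]_w f k w <= ((k.+1%:R ^+ 2)^-1)%:E)%E.
  rewrite (_ : (fun w => f k w) = fun w =>
      ((((k.+1%:R ^+ 2) ^+ 2)^-1)%:E * ((S (k.+1 ^ 2)%N w) ^+ 2)%:E)%E).
    rewrite ge0_integralZl//; last 2 first.
    - by apply: measurableT_comp => //; apply: measurable_funX.
    - by move=> w _; rewrite lee_fin sqr_ge0.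
    apply: le_trans (lee_wpmul2l _ (S2 _)) _.
      by rewrite lee_fin invr_ge0 !exprn_ge0.
    by rewrite -EFinM lee_fin natrX expr2 [in leLHS]invfM mulfVK//.
  by apply/funext => w; rewrite /f -EFinM expr_div_n mulrC.
have sumf : (\int[P]_w (\sum_(k <oo) f k w) < +oo)%E.
  rewrite integral_nneseries//.
  apply: (@le_lt_trans _ _ 2%:E); last by rewrite ltry.
  apply: lime_le.
    by apply: is_cvg_nneseries => k _ _; exact: integral_ge0.
  apply: nearW => n.
  apply: (@le_trans _ _ (\sum_(0 <= k < n) ((k.+1%:R ^+ 2)^-1)%:E)%E).
    by apply: lee_sum => k _; exact: intf.
  by rewrite sumEFin lee_fin big_mkord sum_inv_squares_le.
have msum : measurable_fun setT (fun w => \sum_(k <oo) f k w)%E.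
  by apply: ge0_emeasurable_sum => //.
have : P.-integrable setT (fun w => \sum_(k <oo) f k w)%E.
  apply/integrableP; split => //.
  under eq_integral do rewrite gee0_abs ?nneseries_ge0//.
  exact: sumf.
move=> /(integrable_ae measurableT); apply: filterS => w /(_ I) wfin.
apply: cvg_average_of_squares => //.
have : cvgn (series (fun k => (S (k.+1 ^ 2)%N w / k.+1%:R ^+ 2) ^+ 2)).
  apply: nondecreasing_is_cvgn.
    by apply: nondecreasing_series => n _ _; exact: sqr_ge0.
  exists (fine (\sum_(k <oo) f k w)%E) => _ [n _ <-].
  rewrite -lee_fin fineK// /series/= -sumEFin.
  apply: nneseries_lim_ge => k _ _; exact: f0.
move=> /cvg_series_cvg_0 h.
have : Num.sqrt ((S (k.+1 ^ 2)%N w / k.+1%:R ^+ 2) ^+ 2) @[k --> \oo] --> Num.sqrt (0 : R).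
  by apply: continuous_cvg => //; exact: sqrt_continuous.
rewrite sqrtr0; under eq_fun do rewrite sqrtr_sqr.
by move/norm_cvg0P.
Qed.

End law_of_large_numbers.

(** * Averages of orthogonal variables *)

Section orthogonal_averages.
Context {R : realType} {A : PointedFinite.type}.
Local Notation P := (@bernoulli_measure R A).
Local Notation C := (Cplx R).
Local Notation Re := (@complex.Re R).
Local Notation Im := (@complex.Im R).

Lemma depends_on_prefixW (U : Type) L M (f : words A -> U) : (L <= M)%N ->
  depends_on_prefix L f -> depends_on_prefix M f.
Proof. by move=> LM Lf x y xy; apply: Lf => n nL; apply: xy; exact: leq_trans LM. Qed.

Lemma bounded_prefix L (f : words A -> R) : depends_on_prefix L f ->
  [bounded f x | x in [set: words A]].
Proof.
(* The sum over all prefixes of length [L] is a crude substitute for the maximum. *)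
move=> Lf; exists
 (\sum_(w : {ffun 'I_L -> A}) `|f (extend w)|); split.
  exact: num_real.
move=> M ltM x _; apply/ltW; apply: le_lt_trans ltM.
pose w := [ffun i : 'I_L => x i].
rewrite /= (Lf x (extend w)); last by move=> n nL; rewrite /extend insubT/= ffunE.
rewrite (bigD1 w)//= lerDl; exact: sumr_ge0.
Qed.

Lemma integrable_prefix L (f : words A -> R) : depends_on_prefix L f ->
  P.-integrable setT (EFin \o f).
Proof.
move=> Lf; apply: measurable_bounded_integrable => //.
- by rewrite (le_lt_trans (probability_le1 _ _)) ?ltry.
- exact: measurable_fun_prefix Lf.
- exact: bounded_prefix Lf.
Qed.

Lemma Rintegral_preserves g L (f : words A -> R) : preserves_bernoulli R g ->
  depends_on_prefix L f ->
  Rintegral P setT (f \o g) = Rintegral P setT f.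
Proof.
move=> [mg gP] Lf; rewrite /Rintegral; congr fine.
have mf := measurable_fun_prefix Lf.
pose X : {mfun words A >-> words A} :=
  HB.pack g (isMeasurableFun.Build _ _ _ _ _ mg).
have mf' : measurable_fun setT (EFin \o f) by apply: measurableT_comp.
have Lfg : P.-integrable setT ((EFin \o f) \o X).
  have [M fM] : exists M, forall x, `|f x| <= M.
    have [M [_ bM]] := bounded_prefix Lf.
    by exists (M + 1) => x; apply: bM; rewrite ?ltrDl.
  apply: (@measurable_bounded_integrable _ _ _ _ (f \o g)) => //.
  - by rewrite (le_lt_trans (probability_le1 _ _)) ?ltry.
  - exact: measurableT_comp.
  - exists M; split; first exact: num_real.
    by move=> M' MM' x _ /=; apply: le_trans (fM _) (ltW MM').
rewrite -[LHS](@integral_distribution _ _ _ _ _ P X (EFin \o f))//.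
by apply: eq_measure_integral => E mE _; exact: gP.
Qed.

(* The integral [c] of [F] satisfies [c = om * c]; the proof handles its real and
   imaginary parts. *)
Lemma Rintegral_rotation g L (om : C) (F : words A -> C) :
  preserves_bernoulli R g -> depends_on_prefix L F -> om != 1 ->
  (forall x, F (g x) = om * F x) -> Rintegral P setT (Re \o F) = 0.
Proof.
move=> gP LF om1 Fg.
have LRe : depends_on_prefix L (Re \o F) by move=> x y /LF /= ->.
have LIm : depends_on_prefix L (Im \o F) by move=> x y /LF /= ->.
have iRe := integrable_prefix LRe; have iIm := integrable_prefix LIm.
have := Rintegral_preserves gP LRe; have := Rintegral_preserves gP LIm.
have -> : (Re \o F) \o g = (fun x => Re om * Re (F x) - Im om * Im (F x)).
  by apply/funext => x /=; rewrite Fg; case: (om) => a b; case: (F x).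
have -> : (Im \o F) \o g = (fun x => Re om * Im (F x) + Im om * Re (F x)).
  by apply/funext => x /=; rewrite Fg; case: (om) => a b; case: (F x).
have iZ (c : R) (h : words A -> R) : P.-integrable setT (EFin \o h) ->
    P.-integrable setT (EFin \o (fun x => c * h x)).
  by move=> /(integrableZl measurableT c).
rewrite RintegralD//; [|exact: iZ|exact: iZ].
rewrite RintegralB//; [|exact: iZ|exact: iZ].
rewrite !RintegralZl//.
set J := Rintegral _ _ _; set I := Rintegral _ _ _ => JE IE.
case: om om1 JE IE {Fg} => a b om1 /= JE IE.
(* This is the real part of (1 - om) c = 0 after multiplication by the conjugate of 1 - om; the
   factor in front is |1 - om|^2. *)
have : ((1 - a) ^+ 2 + b ^+ 2) * I = 0.
  transitivity ((1 - a) * (I - (a * I - b * J)) - b * (J - (a * J + b * I))).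
    by ring.
  by rewrite IE JE !subrr !mulr0 subrr.
move/eqP; rewrite mulf_eq0 => /orP[|/eqP//].
rewrite paddr_eq0 ?sqr_ge0// !sqrf_eq0 subr_eq0 => /andP[/eqP a1 /eqP b0].
by move: om1; rewrite -a1 b0 eqxx.
Qed.

(** The norm on [C] takes its values in [C]; integrals and second moments need the modulus as a real
    number. *)
Definition modc (z : C) : R := Num.sqrt (Re z ^+ 2 + Im z ^+ 2).

Lemma modcE z : `|z| = ((modc z)%:C)%C :> C.
Proof. exact: normc_def. Qed.

Lemma modc_ge0 z : 0 <= modc z.
Proof. exact: sqrtr_ge0. Qed.

Lemma modc_sqr z : modc z ^+ 2 = Re z ^+ 2 + Im z ^+ 2.
Proof. by rewrite sqr_sqrtr// addr_ge0 ?sqr_ge0. Qed.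

Lemma modc_dist (a b : C) : `|modc a - modc b| <= modc (a - b).
Proof.
have modcD (x y : C) : modc (x + y) <= modc x + modc y.
  by have := ler_normD x y; rewrite !modcE -rmorphD/= lecR.
have modcN (x : C) : modc (- x) = modc x.
  by apply: complexI; rewrite -!modcE normrN.
have h (x y : C) : modc x - modc y <= modc (x - y).
  by rewrite lerBlDr (le_trans _ (modcD _ _))// subrK.
by rewrite ler_norml h andbT lerNl opprB -(modcN (a - b)) opprB h.
Qed.

Lemma Re_sum n (F : 'I_n -> C) : Re (\sum_(i < n) F i) = \sum_(i < n) Re (F i).
Proof. by apply: (big_morph Re) => [[a b] [a' b']|]. Qed.

Lemma squeeze_modc0 (f : nat -> C) (g : nat -> R) :
  (forall N, modc (f N) <= g N) -> g N @[N --> \oo] --> (0 : R) ->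
  f N @[N --> \oo] --> (0 : C).
Proof.
move=> fg /cvgr0Pnorm_le g0; apply/cvgr0Pnorm_le => -[e e'].
(* Positivity in [C] forces the imaginary part of the threshold to vanish, which leaves a real
   one. *)
rewrite ltcE/= => /andP[/eqP -> e0].
have [N0 _ HN] := g0 _ e0; exists N0 => // N /= /HN geN.
rewrite modcE lecR; apply: le_trans (fg N) _.
exact: le_trans (ler_norm _) geN.
Qed.

(** The map [g] attached to a pair n < k gives the product of [X n] and the conjugate of [X k]
    integral 0, so the variables are orthogonal and the strong law for second moments applies to the
    moduli of their partial sums. *)
Lemma ae_cvg_rotation_average (X : nat -> words A -> C) :
  (forall n, exists L, depends_on_prefix L (X n)) ->
  (forall n x, modc (X n x) <= 1) ->
  (forall n k, (n < k)%N -> exists g om, [/\ preserves_bernoulli R g, om != 1 &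
    forall x, X n (g x) * (X k (g x))^* = om * (X n x * (X k x)^*)]) ->
  {ae P, forall x, (\sum_(n < N) X n x) / N%:R @[N --> \oo] --> (0 : C)}.
Proof.
move=> LX X1 Xrot.
pose S N x := modc (\sum_(n < N) X n x).
have LS N : exists L, forall k, (k < N)%N -> depends_on_prefix L (X k).
  elim: N => [|N [L IH]]; first by exists 0%N.
  have [M LM] := LX N; exists (maxn L M) => k.
  rewrite ltnS leq_eqVlt => /predU1P[->|kN].
    exact: depends_on_prefixW (leq_maxr _ _) LM.
  exact: depends_on_prefixW (leq_maxl _ _) (IH _ kN).
have LSum N : exists L, depends_on_prefix L (fun x => \sum_(n < N) X n x).
  have [L LN] := LS N; exists L => x y xy.
  by apply: eq_bigr => n _; exact: LN.
(* Adding [X N] raises the second moment by at most 1: the cross terms with the earlier variables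
   integrate to 0. *)
have S2 N : Rintegral P setT (fun x => S N x ^+ 2) <= N%:R.
  elim: N => [|N IH].
    rewrite (@eq_Rintegral _ _ _ P setT (cst 0)) ?Rintegral_cst ?mul0r// => x _.
    by rewrite /S big_ord0 modc_sqr/= expr0n/= addr0.
  have [L LN] := LS N.+1.
  have LN' k : (k < N)%N -> depends_on_prefix L (X k).
    by move=> kN; apply: LN; rewrite ltnS ltnW.
  pose cross n x := Re (X n x * (X N x)^*).
  have Lcross n : (n < N)%N -> depends_on_prefix L (cross n).
    by move=> nN x y xy; rewrite /cross (LN' _ nN _ _ xy) (LN _ (ltnSn N) _ _ xy).
  have icross n : (n < N)%N -> Rintegral P setT (cross n) = 0.
    move=> nN; have [g [om [gP om1 gX]]] := Xrot n N nN.
    apply: (@Rintegral_rotation g L om (fun x => X n x * (X N x)^*)) => //.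
    by move=> x y xy; rewrite (LN' _ nN _ _ xy) (LN _ (ltnSn N) _ _ xy).
  have icrossS M : (M <= N)%N ->
      Rintegral P setT (fun x => \sum_(n < M) cross n x) = 0.
    elim: M => [_|M IHM MN].
      rewrite (@eq_Rintegral _ _ _ P setT (cst 0)) ?Rintegral_cst ?mul0r// => x _.
      by rewrite big_ord0.
    under eq_Rintegral do rewrite big_ord_recr/=.
    rewrite RintegralD//; first by rewrite IHM ?icross ?addr0// ltnW.
    - apply: (@integrable_prefix L) => x y xy; apply: eq_bigr => n _.
      by apply: Lcross => //; apply: leq_trans MN; rewrite ltnS ltnW.
    - exact: (@integrable_prefix L _ (Lcross _ MN)).
  have SE x : S N.+1 x ^+ 2 =
      S N x ^+ 2 + (modc (X N x) ^+ 2 + 2 * \sum_(n < N) cross n x).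
    rewrite /S big_ord_recr/= /cross -Re_sum -mulr_suml !modc_sqr.
    case: (\sum_(n < N) X n x) => a b; case: (X N x) => a' b' /=.
    by ring.
  under eq_Rintegral do rewrite SE.
  have LX2 : depends_on_prefix L (fun x => modc (X N x) ^+ 2).
    by move=> x y xy; rewrite (LN _ (ltnSn N) _ _ xy).
  have Lcr : depends_on_prefix L (fun x => \sum_(n < N) cross n x).
    by move=> x y xy; apply: eq_bigr => n _; exact: Lcross.
  have LSN : depends_on_prefix L (fun x => S N x ^+ 2).
    move=> x y xy; rewrite /S; congr (modc _ ^+ 2).
    by apply: eq_bigr => n _; exact: LN'.
  have L2 : depends_on_prefix L (fun x => 2 * \sum_(n < N) cross n x).
    by move=> x y xy; rewrite (Lcr _ _ xy).
  have LX2' : depends_on_prefix L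
      (fun x => modc (X N x) ^+ 2 + 2 * \sum_(n < N) cross n x).
    by move=> x y xy; rewrite (L2 _ _ xy) (LX2 _ _ xy).
  rewrite RintegralD//; [|exact: integrable_prefix LSN|exact: integrable_prefix LX2'].
  rewrite RintegralD//; [|exact: integrable_prefix LX2|exact: integrable_prefix L2].
  rewrite RintegralZl//; last exact: integrable_prefix Lcr.
  rewrite icrossS// mulr0 addr0 -natr1 lerD//.
  rewrite -[leRHS](_ : Rintegral P setT (cst 1) = 1); last first.
    by rewrite Rintegral_cst//= probability_setT mul1r.
  apply: le_Rintegral => //.
  - exact: integrable_prefix LX2.
  - by apply: (@integrable_prefix 0).
  - by move=> x _; rewrite expr_le1// modc_ge0.
have : {ae P, forall x, S N x / N%:R @[N --> \oo] --> (0 : R)}.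
  apply: ae_cvg_average_of_squares.
  - move=> N; have [L LN] := LSum N.
    by apply: (@measurable_fun_prefix _ _ _ L) => x y /LN; rewrite /S => ->.
  - move=> N x; rewrite (le_trans (modc_dist _ _))//.
    by rewrite big_ord_recr/= addrAC subrr add0r.
  - move=> N; have [L LN] := LSum N.
    have LS2 : depends_on_prefix L (fun x => S N x ^+ 2).
      by move=> x y /LN; rewrite /S => ->.
    have /integrable_fin_num := integrable_prefix LS2.
    move=> /(_ measurableT) h.
    by rewrite -(fineK h) lee_fin; exact: S2.
apply: filterS => x; apply: squeeze_modc0 => N.
suff -> : modc ((\sum_(n < N) X n x) / N%:R) = S N x / N%:R by [].
apply: complexI; rewrite -modcE normrM normfV modcE normr_nat.
by rewrite rmorphM/= fmorphV/= rmorph_nat.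
Qed.

End orthogonal_averages.

(** * Roots of unity and the index *)

Section roots_of_unity.
Context {R : realType}.
Local Notation C := (Cplx R).

Definition zeta (m : nat) : C := cexpi (2 * pi * 1%:R / m%:R : R).

Lemma cexpiD (s t : R) : cexpi (s + t) = cexpi s * cexpi t :> C.
Proof.
by rewrite /cexpi cosD sinD [sin s * _ + _]addrC.
Qed.

Lemma cexpiX (t : R) n : cexpi t ^+ n = cexpi (t * n%:R) :> C.
Proof.
elim: n => [|n IH]; first by rewrite mulr0 /cexpi cos0 sin0.
by rewrite exprS IH -cexpiD -natr1 mulrDr mulr1 addrC.
Qed.

Lemma zetaX m j : zeta m ^+ j = cexpi (2 * pi * j%:R / m%:R : R).
Proof. by rewrite /zeta cexpiX mulr1 mulrAC. Qed.

Lemma norm_cexpi (t : R) : `|cexpi t| = 1 :> C.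
Proof. by rewrite modcE /modc /= cos2Dsin2 sqrtr1. Qed.

Lemma cexpi_period (k : nat) : cexpi (2 * pi * k%:R : R) = 1 :> C.
Proof.
rewrite -cexpiX (_ : cexpi _ = 1) ?expr1n//.
by rewrite /cexpi mulrC mulr_natr cos2pi sin2pi.
Qed.

Lemma zeta_expm m : (0 < m)%N -> zeta m ^+ m = 1.
Proof.
move=> m0; rewrite zetaX -(cexpi_period 1) mulr1 mulfK// pnatr_eq0; lia.
Qed.

(** The real part is cos 2t = 1 - 2 sin^2 t with t = pi j / m strictly between 0 and pi, where the
    sine is positive. *)
Lemma zetaX_neq1 m j : (0 < j < m)%N -> zeta m ^+ j != 1.
Proof.
move=> /andP[j0 jm]; rewrite zetaX; apply/eqP => -[+ _].
have m0 : 0 < m%:R :> R by rewrite ltr0n; lia.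
pose t : R := pi * j%:R / m%:R.
have -> : 2 * pi * j%:R / m%:R = t *+ 2 by rewrite /t; ring.
rewrite cos_mulr2n => /eqP; apply/negP.
have st : 0 < sin t.
  apply: sin_gt0_pi; apply/andP; split.
    by rewrite divr_gt0// mulr_gt0 ?pi_gt0 ?ltr0n.
  by rewrite ltr_pdivrMr// ltr_pM2l ?pi_gt0// ltr_nat.
have := cos2Dsin2 t; have : 0 < sin t ^+ 2 by rewrite exprn_gt0.
by move=> ? ?; apply/eqP; lra.
Qed.

Lemma zeta_neq0 m : zeta m != 0.
Proof. by rewrite -normr_eq0 norm_cexpi oner_eq0. Qed.

(** Every element of U(k) has [k]-th power 1, whereas [zeta m ^+ k] is not 1 for 0 < k < m. *)
Lemma zeta_notin_unity_roots m k : (2 <= k < m)%N ->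
  ~ (unity_roots (Some k) `|` [set 0]) (zeta m).
Proof.
move=> /andP[k2 km] [[j jk jE]|/eqP]; last by rewrite (negbTE (zeta_neq0 _)).
have : zeta m ^+ k != 1 by apply: zetaX_neq1; lia.
have k0 : k%:R != 0 :> R by rewrite pnatr_eq0 -lt0n ltnW.
by rewrite -jE cexpiX mulfVK// cexpi_period eqxx.
Qed.

Lemma cpow_zetaX m (u k : nat) : cpow (zeta m ^+ u) k%:Z = (zeta m ^+ k) ^+ u.
Proof.
rewrite /cpow expf_eq0 (negbTE (zeta_neq0 _)) andbF -exprnP.
by rewrite -!exprM mulnC.
Qed.

Lemma cpow0 (k : int) : cpow (0 : C) k = 0.
Proof. by rewrite /cpow eqxx. Qed.

Lemma norm_cpow_le1 (z : C) (k : nat) : circle0 z -> `|cpow z k| <= 1.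
Proof.
rewrite /cpow => -[z1|->]; last by rewrite eqxx normr0.
case: ifP => _; first by rewrite normr0.
by rewrite -exprnP normrX z1 expr1n.
Qed.

Lemma sum_unity_powers (m : nat) (x : C) : x ^+ m = 1 ->
  \sum_(i < m) x ^+ i = if x == 1 then m%:R else 0.
Proof.
move=> xm; case: eqVneq => [->|x1].
  by under eq_bigr do rewrite expr1n; rewrite sumr_const card_ord.
have /eqP := subrX1 x m; rewrite xm subrr eq_sym mulf_eq0 subr_eq0.
by rewrite (negbTE x1) => /eqP.
Qed.

(** Fourier inversion on Z/m: for a root of unity [z] the sum is geometric with ratio z / zeta. For
    [z = 0] the convention that [cpow 0 0] is 0 also removes the term [i = 0]. *)
Lemma zeta_indicator (m : nat) (z : C) : (2 <= m)%N ->
  (unity_roots (Some m) `|` [set 0]) z ->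
  \sum_(i < m) zeta m ^- i * cpow z i%:Z = if z == zeta m then m%:R else 0.
Proof.
move=> m2 [[j jm <-]|->]; last first.
  rewrite eq_sym (negbTE (zeta_neq0 _)) big1// => i _.
  by rewrite cpow0 mulr0.
rewrite -zetaX.
under eq_bigr => i _ do rewrite cpow_zetaX exprAC -exprVn -exprMn.
rewrite sum_unity_powers.
  by rewrite mulrC -(inj_eq (mulIf (zeta_neq0 m))) mulfVK ?zeta_neq0// mul1r.
by rewrite exprMn exprVn exprAC zeta_expm ?expr1n ?invr1 ?mul1r//; lia.
Qed.

End roots_of_unity.

Lemma cvg0_mull (K : numFieldType) (a : K) (f : nat -> K) :
  f N @[N --> \oo] --> 0 -> a * f N @[N --> \oo] --> 0.
Proof. by move=> f0; rewrite -[X in _ --> X](mulr0 a); exact: cvgMl_tmp. Qed.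

(** * The index of a sequence with vanishing correlations *)

Section index.
Context {R : realType}.
Local Notation C := (Cplx R).
Implicit Types z : nat -> C.

Lemma cvg_sum_ord m (f : 'I_m -> nat -> C) (l : 'I_m -> C) :
  (forall i, f i N @[N --> \oo] --> l i) ->
  \sum_(i < m) f i N @[N --> \oo] --> \sum_(i < m) l i.
Proof.
elim: m f l => [|m IH] f l fl.
  by rewrite big_ord0; under eq_fun do rewrite big_ord0; exact: cvg_cst.
rewrite big_ord_recr; under eq_fun do rewrite big_ord_recr.
by apply: cvgD => //; exact: IH.
Qed.

(** The number [c] is the density of the support of [z]. When [zeta_indicator] is averaged along
    [z], only the term [i = 0] survives, so the value [zeta m] has density [c / m], which is not
    0. *)
Lemma index_of_vanishing_correlations (m : nat) z (c : C) : (2 <= m)%N ->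
  (forall n, (unity_roots (Some m) `|` [set 0]) (z n)) ->
  vanishing_correlations (Some m) z -> c != 0 ->
  (\sum_(n < N) cpow (z n) 0) / N%:R @[N --> \oo] --> c ->
  is_index (Some m) z.
Proof.
move=> m2 zU vz c0 zc; split => //.
  rewrite /index_bound /density_zero (_ : [set n | _] = set0).
    apply: cvg_near_cst; apply: nearW => N.
    rewrite (_ : #|_| = 0%N) ?mul0r//.
    by apply: eq_card0 => n; rewrite !inE; apply/asboolP.
  by rewrite -subset0 => n /=; apply; exact: zU.
case=> // k k2 dk; rewrite /le_index leqNgt; apply/negP => km.
have cvg1 : (\sum_(n < N) (if z n == zeta m then m%:R else 0)) / N%:R
    @[N --> \oo] --> c.
  have -> : (fun N : nat => (\sum_(n < N) (if z n == zeta m then m%:R else 0 : C)) / N%:R)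
      = (fun N : nat => \sum_(i < m) zeta m ^- i *
           ((\sum_(n < N) cpow (z n) i%:Z) / N%:R)).
    apply/funext => N; under [RHS]eq_bigr do rewrite mulrA.
    rewrite -mulr_suml; congr (_ / _).
    under [RHS]eq_bigr do rewrite mulr_sumr.
    rewrite exchange_big/=; apply: eq_bigr => n _.
    by rewrite zeta_indicator.
  have -> : c = \sum_(i < m) (if val i == 0%N then c else 0).
    by rewrite -big_mkcond (big_pred1 (Ordinal (ltnW m2))).
  apply: cvg_sum_ord => i.
  case: ifPn => [/eqP ->|i0].
    by rewrite expr0 invr1; under eq_fun do rewrite mul1r.
  suff h : (fun N : nat => (\sum_(n < N) cpow (z n) i%:Z) / N%:R) @ \oo --> (0 : C).
    by apply: cvg0_mull.
  have -> : (fun N : nat => (\sum_(n < N) cpow (z n) i%:Z) / N%:R) =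
      (fun N : nat => (\sum_(n < N) \prod_(j < 1) cpow (z (n + 0)%N) i%:Z) / N%:R).
    apply/funext => N; congr (_ / _); apply: eq_bigr => n _.
    by rewrite big_ord1 addn0.
  apply: (vz 1%N (fun=> 0%N) (fun=> i%:Z)) => //.
  - by move=> a b; rewrite !ord1.
  - by move=> _ /=; rewrite ltz_nat ltn_ord.
  - by exists ord0.
(* Each [n] with [z n = zeta m] lies in the exceptional set of [k], which has density zero by
   [dk]. *)
have cvg0 : (\sum_(n < N) (if z n == zeta m then m%:R else 0)) / N%:R
    @[N --> \oo] --> (0 : C).
  apply: (@squeeze_modc0 _ _ (fun N => m%:R *
    (#|[pred n : 'I_N | `[< [set n | ~ (unity_roots (Some k) `|` [set 0]) (z n)] n >]]|%:R
      / N%:R))); last first.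
    by apply: cvg0_mull; exact: dk.
  move=> N; rewrite -lecR -modcE normrM normfV normr_nat rmorphM/= fmorph_div/= !rmorph_nat.
  rewrite mulrA ler_wpM2r ?invr_ge0//.
  apply: (le_trans (ler_norm_sum _ _ _)).
  rewrite -sum1_card natr_sum mulr_sumr mulr1 [leRHS]big_mkcond/=.
  apply: ler_sum => n _; rewrite inE.
  case: eqP => [zn|_]; last by rewrite normr0; case: ifP.
  rewrite normr_nat ifT//; apply/asboolP; rewrite /= zn.
  by apply: zeta_notin_unity_roots; rewrite k2.
by move/eqP: c0; apply; exact: (cvg_unique _ cvg1 cvg0).
Qed.

End index.

(** * The process *)

Lemma ae_forall_countable d (T : measurableType d) (R : realType)
    (mu : {measure set T -> \bar R}) (I : countType) (Q : I -> T -> Prop) :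
  (forall i, {ae mu, forall x, Q i x}) -> {ae mu, forall x, forall i, Q i x}.
Proof.
move=> aeQ.
have : {ae mu, forall x, forall n, if unpickle n is Some i then Q i x else True}.
  apply: ae_foralln => n; case: (unpickle n) => [i|]; first exact: aeQ.
  exact: aeW.
by apply: filterS => x Qx i; have := Qx (pickle i); rewrite pickleK.
Qed.

Section chowla_process.
Context {R : realType} (M : nat).
Local Notation m := M.+2.
Local Notation C := (Cplx R).

(** A letter is a pair (u, b). Writing the modulus as [M.+2] equips ['I_m] with the ring structure
    of Z/m, so that 1 can be added to [u]. *)
Definition letter : PointedFinite.type := HB.pack ('I_m * bool)%type.

Local Notation P := (@bernoulli_measure R letter).
Local Notation word := (words letter).

Definition process (n : nat) (x : word) : borelC R :=
  if (x n).2 && (x n.+1).2 then zeta m ^+ (x n).1 else 0.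

Definition rotate (p n : nat) (a : letter) : letter :=
  if n == p then (a.1 + 1, a.2) else a.

Definition flip (p n : nat) (a : letter) : letter :=
  if n == p then (a.1, ~~ a.2) else a.

Lemma rotate_preserves p : preserves_bernoulli R (relabel (rotate p)).
Proof.
apply: relabel_preserves => n.
exists (fun a : letter => if n == p then (a.1 - 1, a.2) else a) => -[u b];
  rewrite /rotate; case: (n == p) => //=.
  by rewrite addrK.
by rewrite subrK.
Qed.

Lemma flip_preserves p : preserves_bernoulli R (relabel (flip p)).
Proof.
apply: relabel_preserves => n.
by exists (flip p n) => -[u b]; rewrite /flip; case: (n == p) => //=; rewrite negbK.
Qed.

Lemma process_unity_roots n x : (unity_roots (Some m) `|` [set 0]) (process n x).
Proof.
rewrite /process; case: ifP => _; last by right.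
by left; exists (x n).1; rewrite /= ?zetaX.
Qed.

Lemma process_circle0 n x : circle0 (process n x).
Proof.
case: (process_unity_roots n x) => [[j _ <-]|->]; last by right.
by left; rewrite /circle /= norm_cexpi.
Qed.

Lemma depends_on_prefix_process n : depends_on_prefix n.+2 (process n).
Proof. by move=> x y xy; rewrite /process !xy. Qed.

Lemma measurable_process n : measurable_fun setT (process n).
Proof. exact: measurable_fun_prefix (@depends_on_prefix_process n). Qed.

HB.instance Definition _ n := isMeasurableFun.Build _ _ _ _
  (process n) (measurable_process n).

Lemma cpow_process_rotate p n (k : nat) x :
  cpow (process n (relabel (rotate p) x)) k%:Z =
  (if n == p then zeta m ^+ k else 1) * cpow (process n x) k%:Z.
Proof.
have b2 i : (relabel (rotate p) x i).2 = (x i).2.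
  by rewrite /relabel /rotate; case: ifP.
rewrite /process !b2; case: ifP => _; last by rewrite cpow0 mulr0.
rewrite !cpow_zetaX /relabel /rotate.
case: ifP => _; last by rewrite mul1r.
(* Addition in ['I_m] is reduced modulo [m], which is harmless for powers of an element whose [m]-th
   power is 1. *)
have zk : (zeta m ^+ k) ^+ m = 1 :> C by rewrite exprAC zeta_expm ?expr1n.
by rewrite /= expr_mod// -exprS addn1.
Qed.

(** * Correlations with a nonzero exponent *)

Section correlation.
Variables (r : nat) (a k : 'I_r -> nat).
Hypothesis a_incr : forall i j : 'I_r, (i < j)%N -> (a i < a j)%N.
Hypothesis k_lt : forall j, (k j < m)%N.

Let X n x : C := \prod_(j < r) cpow (process (n + a j) x) (k j)%:Z.

Let a_inj : injective a.
Proof.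
move=> i j aij; apply/val_inj; have [ij|ij|//] := ltngtP i j.
  by have := a_incr ij; rewrite aij ltnn.
by have := a_incr ij; rewrite aij ltnn.
Qed.

Lemma ae_cvg_correlation : (exists j, k j != 0%N) ->
  {ae P, forall x, (\sum_(n < N) X n x) / N%:R @[N --> \oo] --> (0 : C)}.
Proof.
case=> j1 kj1.
case: (@arg_minnP _ j1 (fun j => k j != 0%N) (fun j : 'I_r => val j) kj1) => j0 kj0 j0min.
apply: ae_cvg_rotation_average => [n|n x|n n' nn'].
- exists (n + (\max_(j < r) a j).+2)%N => x y xy; apply: eq_bigr => j _.
  rewrite (@depends_on_prefix_process _ x y)// => i ij; apply: xy.
  apply: leq_trans ij _; rewrite -!addnS leq_add2l !ltnS.
  exact: leq_bigmax.
- rewrite -lecR -modcE normr_prod; apply: prodr_ile1 => j _.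
  by rewrite normr_ge0 norm_cpow_le1//; exact: process_circle0.
exists (relabel (rotate (n + a j0))), (zeta m ^+ k j0); split.
- exact: rotate_preserves.
- by rewrite zetaX_neq1// lt0n kj0 k_lt.
move=> x.
have -> : X n (relabel (rotate (n + a j0)) x) = zeta m ^+ k j0 * X n x.
  rewrite /X (bigD1 j0)//= [in RHS](bigD1 j0)//= mulrA.
  rewrite cpow_process_rotate eqxx; congr (_ * _); apply: eq_bigr => j jj0.
  by rewrite cpow_process_rotate eqn_add2l (inj_eq a_inj) (negbTE jj0) mul1r.
(* A factor of [X n'] at the site [n + a j0] has [a j < a j0] because n < n', hence exponent 0 by
   minimality of [j0]; such a factor depends on bits only. *)
have -> : X n' (relabel (rotate (n + a j0)) x) = X n' x.
  apply: eq_bigr => j _; rewrite cpow_process_rotate.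
  case: eqP => [aj|]; last by rewrite mul1r.
  suff /eqP -> : k j == 0%N by rewrite expr0 mul1r.
  apply: contraT => /j0min j0j.
  have : (a j0 <= a j)%N.
    by move: j0j; rewrite leq_eqVlt => /predU1P[/val_inj ->//|/a_incr/ltnW].
  by lia.
by rewrite mulrA.
Qed.

End correlation.

(** * Density of the support *)

Lemma ae_cvg_flip_average (X : nat -> word -> C) (p : nat -> nat) :
  (forall n, exists L, depends_on_prefix L (X n)) ->
  (forall n x, `|X n x| = 1) ->
  (forall n x, X n (relabel (flip (p n)) x) = - X n x) ->
  (forall n k x, (n < k)%N -> X k (relabel (flip (p n)) x) = X k x) ->
  {ae P, forall x, (\sum_(n < N) X n x) / N%:R @[N --> \oo] --> (0 : C)}.
Proof.
move=> LX X1 Xn Xk; apply: ae_cvg_rotation_average => // [n x|n k nk].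
  by rewrite -lecR -modcE X1.
exists (relabel (flip (p n))), (-1); split; first exact: flip_preserves.
  by rewrite eqr_oppLR -subr_eq0 opprK -mulr2n pnatr_eq0.
by move=> x; rewrite Xn Xk// mulN1r mulNr.
Qed.

(** The bit recentred to mean 0: a flip acts on it as multiplication by -1, so it fits the rotation
    criterion. *)
Definition spin (n : nat) (x : word) : C := if (x n).2 then 1 else -1.

Lemma norm_spin n x : `|spin n x| = 1.
Proof. by rewrite /spin; case: ifP; rewrite ?normrN normr1. Qed.

Lemma spin_flip p n x :
  spin n (relabel (flip p) x) = if n == p then - spin n x else spin n x.
Proof.
by rewrite /spin /relabel /flip; case: (n == p); case: (x n) => u []; rewrite /= ?opprK.
Qed.

(** Expand the product of two neighbouring bits, each written as (1 + spin) / 2. *)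
Lemma cpow_process0E n x :
  cpow (process n x) 0 = 4^-1 * (1 + spin n x + spin n.+1 x + spin n x * spin n.+1 x).
Proof.
have -> : cpow (process n x) 0 = if (x n).2 && (x n.+1).2 then 1 else 0.
  rewrite /process; case: ifP => _; last exact: cpow0.
  by rewrite (cpow_zetaX _ _ 0) expr0 expr1n.
by rewrite /spin; case: (x n).2; case: (x n.+1).2 => /=; field.
Qed.

Lemma cvg_quarter (K : numFieldType) (f g h : nat -> K) :
  f N @[N --> \oo] --> 0 -> g N @[N --> \oo] --> 0 -> h N @[N --> \oo] --> 0 ->
  4^-1 * (N%:R / N%:R + f N + g N + h N) @[N --> \oo] --> (4^-1 : K).
Proof.
move=> f0 g0 h0.
rewrite [X in _ --> X](_ : _ = 4^-1 * (1 + 0 + 0 + 0)); last first.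
  by rewrite !addr0 mulr1.
apply: cvgMl_tmp; apply: cvgD => //; apply: cvgD => //; apply: cvgD => //.
(* The quotient is 0 at [N = 0], so it is constantly 1 only from [N = 1] on. *)
apply: cvg_near_cst; exists 1%N => // N /= N0.
by rewrite divff// pnatr_eq0 -lt0n.
Qed.

Lemma ae_cvg_support : {ae P, forall x,
  (\sum_(n < N) cpow (process n x) 0) / N%:R @[N --> \oo] --> (4^-1 : C)}.
Proof.
have s1 : {ae P, forall x,
    (\sum_(n < N) spin n x) / N%:R @[N --> \oo] --> (0 : C)}.
  apply: (@ae_cvg_flip_average _ id) => [n|n x|n x|n k x nk].
  - by exists n.+1 => x y xy; rewrite /spin xy.
  - exact: norm_spin.
  - by rewrite spin_flip eqxx.
  - by rewrite spin_flip gtn_eqF.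
have s2 : {ae P, forall x,
    (\sum_(n < N) spin n.+1 x) / N%:R @[N --> \oo] --> (0 : C)}.
  apply: (@ae_cvg_flip_average (fun n => spin n.+1) S) => [n|n x|n x|n k x nk].
  - by exists n.+2 => x y xy; rewrite /spin xy.
  - exact: norm_spin.
  - by rewrite spin_flip eqxx.
  - by rewrite spin_flip eqSS gtn_eqF.
have s3 : {ae P, forall x,
    (\sum_(n < N) (spin n x * spin n.+1 x)) / N%:R @[N --> \oo] --> (0 : C)}.
  (* Each product is odd in its left bit, and the products starting later do not involve that
     bit. *)
  apply: (@ae_cvg_flip_average (fun n x => spin n x * spin n.+1 x) id)
      => [n|n x|n x|n k x nk].
  - by exists n.+2 => x y xy; rewrite /spin !xy.
  - by rewrite normrM !norm_spin mulr1.
  - by rewrite !spin_flip eqxx gtn_eqF// mulNr.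
  - by rewrite !spin_flip !gtn_eqF// ltnS ltnW.
move: s1 s2 s3; apply: filterS3 => x h1 h2 h3.
rewrite (_ : (fun N => _) = (fun N : nat => 4^-1 * (N%:R / N%:R +
  (\sum_(n < N) spin n x) / N%:R + (\sum_(n < N) spin n.+1 x) / N%:R +
  (\sum_(n < N) (spin n x * spin n.+1 x)) / N%:R))).
  exact: cvg_quarter.
apply/funext => N; under eq_bigr do rewrite cpow_process0E.
rewrite -mulr_sumr -!mulrDl mulrA; congr (_ * _ / _).
by rewrite !big_split/= sumr_const card_ord.
Qed.

Lemma ae_chowla : {ae P, forall x,
  is_index (Some m) (fun n => process n x) /\ is_chowla (fun n => process n x)}.
Proof.
(* Sites and exponents are packed into tuples of pairs of naturals, a countable type, so that one
   null set serves all correlations at once. *)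
have corr : {ae P, forall x, forall (r : nat) (c : r.-tuple (nat * nat)),
    (forall i j : 'I_r, (i < j)%N -> ((tnth c i).1 < (tnth c j).1)%N) ->
    (forall j, ((tnth c j).2 < m)%N) -> (exists j, (tnth c j).2 != 0%N) ->
    (\sum_(n < N) \prod_(j < r) cpow (process (n + (tnth c j).1) x) (tnth c j).2%:Z)
      / N%:R @[N --> \oo] --> (0 : C)}.
  apply: ae_foralln => r; apply: ae_forall_countable => c.
  have [h1|] := pselect (forall i j : 'I_r,
      (i < j)%N -> ((tnth c i).1 < (tnth c j).1)%N); last first.
    by move=> h; apply: aeW.
  have [h2|] := pselect (forall j, ((tnth c j).2 < m)%N); last first.
    by move=> h; apply: aeW.
  have [h3|] := pselect (exists j, (tnth c j).2 != 0%N); last first.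
    by move=> h; apply: aeW.
  have := @ae_cvg_correlation r (fun j => (tnth c j).1) (fun j => (tnth c j).2) h1 h2 h3.
  by apply: filterS => x h _ _ _.
move: corr ae_cvg_support; apply: filterS2 => x corr supp.
have vc : vanishing_correlations (Some m) (fun n => process n x).
  move=> r a i _ a_incr iE [j0 ij0].
  (* For a finite index the admissible exponents are nonnegative, so passing to absolute values
     loses nothing. *)
  have iN j : i j = `|i j|%N%:Z by have /andP[i0 _] := iE j; rewrite gez0_abs.
  have := corr r [tuple (a j, `|i j|%N) | j < r].
  have -> : (fun N : nat =>
      (\sum_(n < N) \prod_(j < r) cpow (process (n + a j) x) (i j)) / N%:R) =
    (fun N : nat => (\sum_(n < N) \prod_(j < r)
      cpow (process (n + (tnth [tuple (a j, `|i j|%N) | j < r] j).1) x)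
        (tnth [tuple (a j, `|i j|%N) | j < r] j).2%:Z) / N%:R).
    apply/funext => N; congr (_ / _); apply: eq_bigr => n _; apply: eq_bigr => j _.
    by rewrite tnth_mktuple/= -iN.
  apply.
  - by move=> j k jk; rewrite !tnth_mktuple; exact: a_incr.
  - by move=> j; rewrite tnth_mktuple/= -ltz_nat -iN; have /andP[] := iE j.
  - by exists j0; rewrite tnth_mktuple/= absz_eq0.
have idx : is_index (Some m) (fun n => process n x).
  apply: (index_of_vanishing_correlations _ _ vc _ supp) => //.
  by move=> n; exact: process_unity_roots.
by split => //; exists (Some m).
Qed.

(** * Stationarity and failure of independence *)

Lemma measurable_process_event (E : set (nat -> borelC R)) :
  sequence_measurable E -> measurable [set x : word | E (fun n => process n x)].
Proof.
pose S := [set F : set (nat -> borelC R) |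
  measurable [set x : word | F (fun n => process n x)]].
suff /(_ E) : @sequence_measurable R `<=` S by [].
apply: smallest_sub.
  split=> [|F SF|F SF].
  - exact: measurable0.
  - rewrite setTD /S /=; exact: measurableC.
  - exact: (@bigcupT_measurable _ _
      (fun i => [set x : word | F i (fun n => process n x)]) SF).
move=> _ [n [B mB ->]]; rewrite /S /= -[X in measurable X]setTI.
exact: measurable_process.
Qed.

Lemma iter_shift h (x : word) n : iter h (@shift_word letter) x n = x (n + h)%N.
Proof.
elim: h n => [|h IH] n; first by rewrite addn0.
by rewrite iterS /shift_word IH addSnnS.
Qed.

(** The same local rule is applied at every site, so translating the process by [h] amounts to
    shifting the word [h] times, and the shift preserves the measure. *)
Lemma stationary_process : stationary (fun n => (process n : {RV P >-> borelC R})).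
Proof.
move=> h E mE.
have mE' := measurable_process_event mE.
have -> : [set w | E (fun n => process (n + h)%N w)] =
    iter h (@shift_word letter) @^-1` [set w | E (fun n => process n w)].
  apply/seteqP; split=> w; rewrite /preimage/=; congr E; apply/funext => n;
    by rewrite /process !iter_shift addSn.
move: mE'; move: [set w | _] => F mF.
elim: h => // h IH; rewrite -IH.
have [ms sP] := @shift_word_preserves R letter.
rewrite (_ : _ @^-1` F = @shift_word letter @^-1` (iter h (@shift_word letter) @^-1` F)).
  apply: sP; elim: h {IH} => // h IH.
  rewrite (_ : _ @^-1` F = @shift_word letter @^-1` (iter h (@shift_word letter) @^-1` F)).
    by rewrite -[X in measurable X]setTI; exact: ms.
  by apply/seteqP; split=> w; rewrite /preimage/= -iterSr.
by apply/seteqP; split=> w; rewrite /preimage/= -iterSr.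
Qed.

(** Flipping bit [p] preserves the measure and exchanges the parts of [E] where that bit is 1 and 0,
    so each carries half of the mass. *)
Lemma half_bit L p (E : set word) : depends_on_prefix L E ->
  (forall x, E (relabel (flip p) x) = E x) ->
  fine (P (E `&` [set x : word | (x p).2])) = fine (P E) / 2.
Proof.
move=> LE Eflip.
have mE := measurable_prefix_set LE.
have mb : measurable ([set x : word | (x p).2] : set word).
  by apply: (@measurable_prefix_set _ p.+1) => x y; rewrite /mkset => ->.
have fl : P (E `&` [set x : word | (x p).2]) = P (E `&` ~` [set x : word | (x p).2]).
  have [_ fP] := flip_preserves p.
  rewrite -fP; last exact: measurableI.
  congr (P _); apply/seteqP; split=> x; rewrite /preimage/= Eflip /relabel /flip eqxx/=.
    by move=> [Ex /negP].
  by move=> [Ex /negP].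
have PE : P E = (P (E `&` [set x : word | (x p).2]) +
    P (E `&` [set x : word | (x p).2]))%E.
  transitivity (P (E `\` [set x : word | (x p).2]) +
      P (E `&` [set x : word | (x p).2]))%E; first exact: measureDI.
  by congr (_ + _)%E; rewrite setDE; exact/esym/fl.
have PEfin : P (E `&` [set x : word | (x p).2]) \is a fin_num.
  by apply: fin_num_measure; exact: measurableI.
by rewrite PE (fineD PEfin PEfin) -mulr2n -[X in _ = X / 2]mulr_natr mulfK ?pnatr_eq0.
Qed.

Lemma process_neq0E n : process n @^-1` (~` [set 0]) = [set x : word | (x n).2 && (x n.+1).2].
Proof.
apply/seteqP; split=> x; rewrite /preimage/= /process; case: ifP => //.
move=> _ _ /eqP; rewrite expf_eq0 (negbTE (zeta_neq0 _)) andbF.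
by [].
Qed.

Lemma not_independent_process : ~ independent (fun n => (process n : {RV P >-> borelC R})).
Proof.
move=> /(_ [:: 0%N; 1%N] (fun=> ~` [set 0]) isT).
have mB : measurable (~` [set 0] : set (borelC R)).
  apply: sub_sigma_algebra; apply: (@closed_openC C); apply: compact_closed.
    exact: norm_hausdorff.
  exact: compact_set1.
move=> /(_ (fun=> mB)); rewrite !big_cons big_nil mule1 !process_neq0E.
set b : nat -> set word := fun n => [set x : word | (x n).2].
(* The events are rewritten as successive intersections starting from [setT], so that [half_bit]
   contributes one factor 1/2 per bit. *)
have -> : \bigcap_(j in [set` [:: 0%N; 1%N]]) (process j @^-1` (~` [set 0])) =
    setT `&` b 0%N `&` b 1%N `&` b 2%N.
  apply/seteqP; split=> x.
    move=> h; have := h 0%N; have := h 1%N; rewrite !process_neq0E /b/= => /(_ isT).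
    by move=> /andP[h1 h2] /(_ isT) /andP[h0 _].
  move=> [[[_ b0] b1] b2] j; rewrite process_neq0E /= !inE.
  by move=> /orP[|] /eqP ->; apply/andP.
have -> : [set x : word | (x 0%N).2 && (x 1%N).2] = setT `&` b 0%N `&` b 1%N.
  by apply/seteqP; split=> x; rewrite /b/=; [move=> /andP[]|move=> [[_ b0] b1]; apply/andP].
have -> : [set x : word | (x 1%N).2 && (x 2%N).2] = setT `&` b 1%N `&` b 2%N.
  by apply/seteqP; split=> x; rewrite /b/=; [move=> /andP[]|move=> [[_ b0] b1]; apply/andP].
move=> /(congr1 fine).
have LT : depends_on_prefix 0 (setT : set word) by [].
have L1 p : depends_on_prefix p.+1 (setT `&` b p).
  by move=> x y xy; rewrite /b /setI /mkset xy.
have L2 p : depends_on_prefix p.+2 (setT `&` b p `&` b p.+1).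
  by move=> x y xy; rewrite /b /setI /mkset !xy.
have flipb p n x : n != p -> b n (relabel (flip p) x) = b n x.
  by move=> np; rewrite /b /mkset /relabel /flip (negbTE np).
have P1 p : fine (P (setT `&` b p)) = 1 / 2.
  by rewrite (half_bit LT)//= probability_setT.
have P2 p : fine (P (setT `&` b p `&` b p.+1)) = 1 / 2 / 2.
  rewrite (half_bit (L1 p)) ?P1// => x.
  by rewrite /setI /mkset flipb// ltn_eqF.
have P3 : fine (P (setT `&` b 0%N `&` b 1%N `&` b 2%N)) = 1 / 2 / 2 / 2.
  by rewrite (half_bit (L2 0%N)) ?P2.
have mb2 p : P (setT `&` b p `&` b p.+1) \is a fin_num.
  by apply: fin_num_measure; exact: measurable_prefix_set (L2 p).
rewrite fineM; [|exact: mb2|exact: mb2].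
rewrite P3 !P2; lra.
Qed.

End chowla_process.

Theorem mainTheorem4 (R : realType) (m : nat) (hm : (2 <= m)%N) :
  exists (d : measure_display) (T : measurableType d) (P : probability T R)
         (Z : nat -> {RV P >-> borelC R}),
    [/\ forall n w, circle0 (Z n w),
        stationary Z,
        ~ independent Z &
        {ae P, forall w, is_index (Some m) (fun n => Z n w) /\
                         is_chowla (fun n => Z n w)}].
Proof.
case: m hm => [//|[//|M]] _.
exists _, (words (letter M)), (@bernoulli_measure R (letter M)),
  (fun n => (process n : {mfun _ >-> _})).
split.
- exact: process_circle0.
- exact: stationary_process.
- exact: not_independent_process.
- exact: ae_chowla.
Qed.
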